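(* Let $\rho: S \to T$ be an Armendariz map of nilpotent-free semigroups. Then: (1) If $\operatorname{diam} \Gamma(T) \neq 1$, then $\operatorname{diam} \Gamma(S) = \operatorname{diam} \Gamma(T)$. (2) If $\operatorname{diam} \Gamma(T) = 1$, then $\operatorname{diam}\Gamma(S) = 1$ if the map $\Gamma(S) \to \Gamma(T)$ induced by $\rho$ (on vertices, $s \mapsto \rho(s)$) is bijective, and $\operatorname{diam}\Gamma(S) = 2$ otherwise. (3) If $\operatorname{girth} \Gamma(T) < \infty$, then $\operatorname{girth} \Gamma(S) = \operatorname{girth} \Gamma(T)$. (4) If $\operatorname{girth} \Gamma(T) = \infty$, then $\operatorname{girth} \Gamma(S) \in \{4, \infty\}$. (5) $\operatorname{clique} \Gamma(S) = \operatorname{clique} \Gamma(T)$. (6) $\chi(\Gamma(S)) = \chi(\Gamma(T))$.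
   Context: A semigroup with zero is a commutative (multiplicatively written) semigroup $S$ with an absorbing element $0$. It is nilpotent-free if $x^n = 0$ for some positive integer $n$ implies $x=0$. An element $s \in S$ is a zero-divisor if $st=0$ for some nonzero $t\in S$. A set map $g: S \to T$ between nilpotent-free semigroups is an Armendariz map if (i) $g$ is surjective; (ii) for any $s\in S$, $s=0$ if and only if $g(s)=0$; (iii) for any $s,s'\in S$, $ss'=0$ if and only if $g(s)g(s')=0$. (It need not be a homomorphism.) The zero-divisor graph $\Gamma(S)$ of a semigroup with zero $S$ is the simple graph whose vertices are the nonzero zero-divisors of $S$, two distinct vertices $a,b$ being adjacent precisely when $ab=0$. For a graph $G$: $\operatorname{diam} G$ is the supremum of the distances between pairs of vertices (it is $0$ for the empty graph); $\operatorname{girth} G$ is the length of a shortest cycle, or $\infty$ if there are no cycles; $\operatorname{clique} G$ is the supremum of the cardinalities of sets of vertices on which the induced subgraph is complete; $\chi(G)$ is the infimum of the cardinalities of sets $A$ for which there is a map from the vertices of $G$ to $A$ taking different values on adjacent vertices. *)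

(* Defs.v *)
From HB Require Import structures.
From mathcomp Require Import all_boot.
From mathcomp Require Import boolp classical_sets functions cardinality.

Set Implicit Arguments.
Unset Strict Implicit.
Unset Printing Implicit Defensive.

Local Open Scope classical_set_scope.
Local Open Scope card_scope.

Definition enat : Type := option nat.
Definition Fin (n : nat) : enat := Some n.
Definition Infty : enat := None.

Definition enat_le (a b : enat) : bool :=
  match a, b with
  | _, None => true
  | None, Some _ => false
  | Some m, Some n => m <= n
  end.

Definition nat_inf (A : set nat) : enat :=
  if pselect (exists n, `[< A n >]) is left exA then Fin (ex_minn exA)
  else Infty.

Definition enat_sup (A : set enat) : enat :=
  nat_inf [set n | forall a, A a -> enat_le a (Fin n)].

Lemma nat_infP (A : set nat) n :
  nat_inf A = Fin n <-> A n /\ forall m, A m -> n <= m.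
Proof.
rewrite /nat_inf; case: pselect => [exA|nexA]; last first.
  by split=> // -[An _]; case: nexA; exists n; apply/asboolP.
case: ex_minnP => m /asboolP Am m_min; split=> [[<-]|[An n_min]].
  by split=> // k Ak; apply: m_min; apply/asboolP.
congr Some; apply/eqP; rewrite eqn_leq n_min // andbT.
by apply: m_min; apply/asboolP.
Qed.

Lemma nat_inf_infty (A : set nat) : nat_inf A = Infty <-> A = set0.
Proof.
rewrite /nat_inf; case: pselect => [exA|nexA]; split=> //.
  by move=> A0; have [n /asboolP An] := exA; rewrite A0 in An.
by move=> _; rewrite -subset0 => n An; case: nexA; exists n; apply/asboolP.
Qed.

(* Cardinals are represented by types, ordered by [#<=] and identified up to  *)
(* [#=].  Every nonempty class of cardinals has a least element, see          *)
(* [card_infP], so the default value [void] only serves for the empty class.  *)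
Definition is_card_inf (F : Type -> Prop) (K : Type) : Prop :=
  F K /\ forall L : Type, F L -> [set: K] #<= [set: L].

Definition card_inf (F : Type -> Prop) : Type :=
  if pselect (exists K, is_card_inf F K) is left exK then projT1 (cid exK)
  else void.

Definition card_ub (F : Type -> Prop) (K : Type) : Prop :=
  forall L : Type, F L -> [set: L] #<= [set: K].

Definition card_sup (F : Type -> Prop) : Type := card_inf (card_ub F).

Lemma card_leTTP (A B : Type) :
  reflect (exists f : A -> B, injective f) ([set: A] #<= [set: B]).
Proof.
apply: (iffP card_leP) => [[f]|[f f_inj]].
  exists (val \o f \o to_setT) => x y /= /val_inj.
  by move=> /(@inj _ _ _ f _ _ (mem_set I) (mem_set I)) /(congr1 val).
apply/injfunPex; exists (to_setT \o f \o val) => //.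
by move=> x y _ _ /= /(congr1 val) /= /f_inj /val_inj.
Qed.

(* Honig's argument: in the product of the family, a maximal set on which all *)
(* the projections are injective is mapped onto one of the factors.           *)
Lemma card_family_min (I : Type) (A : I -> Type) :
  I -> exists i, forall j, [set: A i] #<= [set: A j].
Proof.
move=> i0; pose P := forall i : I, A i.
pose injs (M : set P) :=
  forall (i : I) (p q : P), M p -> M q -> p i = q i -> p = q.
have [G G_inj G_tot|M [M_inj M_max]] := @Zorn_bigcup P [set M | injs M].
  move=> i p q [B GB Bp] [C GC Cq]; have [BC|CB] := G_tot _ _ GB GC.
    exact: (G_inj C GC i _ _ (BC _ Bp)).
  exact: (G_inj B GB i _ _ Bp (CB _ Cq)).
have [i i_onto] : exists i : I, forall k : A i, exists p, M p /\ p i = k.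
  apply: contrapT => /forallNP noti.
  have ex_p (i : I) : exists k : A i, forall q, M q -> q i <> k.
    have /existsNP[k kP] := noti i.
    by exists k => q Mq qk; apply: kP; exists q.
  pose p : P := fun i => projT1 (cid (ex_p i)).
  have pP i q : M q -> q i <> p i by exact: (projT2 (cid (ex_p i))).
  apply: (M_max (M `|` [set p])).
    split=> [q Mq|/(_ p) Mp]; first by left.
    by apply: (pP i0 p) => //; apply: Mp; right.
  move=> i q r [Mq|->] [Mr|->] //; first exact: M_inj.
    by move=> /pP -/(_ Mq).
  by move=> /esym /pP -/(_ Mr).
exists i => j; pose f k := projT1 (cid (i_onto k)).
have fP k : M (f k) /\ f k i = k by exact: (projT2 (cid (i_onto k))).
apply/card_leTTP; exists (fun k => f k j) => k l fkl.
have [[Mk fk] [Ml fl]] := (fP k, fP l).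
by rewrite -fk -fl (M_inj j _ _ Mk Ml fkl).
Qed.

Lemma card_le_totalTT (A B : Type) :
  [set: A] #<= [set: B] \/ [set: B] #<= [set: A].
Proof.
have [[] h] := card_family_min (fun b : bool => if b then A else B) true.
  by left; exact: (h false).
by right; exact: (h true).
Qed.

Lemma is_card_inf_exists (F : Type -> Prop) :
  (exists K, F K) -> exists K, is_card_inf F K.
Proof.
move=> [K FK].
pose I := {A : set K | exists L, F L /\ [set: L] #= A}.
have i0 : I by exists setT, K; split=> //; exact: card_eqxx.
have [[A [L [FL LA]]] /= A_min] := card_family_min (fun i : I => sval i) i0.
have A_le (B : set K) : (exists L, F L /\ [set: L] #= B) -> [set: L] #<= B.
  move=> BP; have := A_min (exist _ B BP) => /=.
  rewrite (card_le_eql (card_setT A)) (card_le_eqr (card_setT B)).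
  by rewrite -(card_le_eql LA).
exists L; split=> // L' FL'.
have [KL'|/card_leTTP[f f_inj]] := card_le_totalTT K L'.
  apply: card_le_trans KL'; apply: A_le; exists K.
  by split=> //; exact: card_eqxx.
have fL' : range f #= [set: L'] by apply: inj_card_eq => x y _ _ /f_inj.
rewrite -(card_le_eqr fL'); apply: A_le; exists L'; split=> //.
exact: card_esym.
Qed.

Lemma card_infP (F : Type -> Prop) :
  (exists K, F K) -> is_card_inf F (card_inf F).
Proof.
move=> /is_card_inf_exists exK; rewrite /card_inf.
by case: pselect => // h; exact: (projT2 (cid h)).
Qed.

Record sgraph := SGraph {
  vertex :> eqType;
  adj : rel vertex;
  adj_sym : symmetric adj;
  adj_irr : irreflexive adj
}.
Arguments adj {s} : rename.

Section GraphInvariants.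
Variable G : sgraph.

Definition walk_of_length (n : nat) (x y : G) : Prop :=
  exists p : seq G, [/\ size p = n, path adj x p & last x p = y].

Definition dist (x y : G) : enat := nat_inf [set n | walk_of_length n x y].

Definition diam : enat := enat_sup [set dist xy.1 xy.2 | xy in [set: G * G]].

(* [ucycle] asks for pairwise distinct vertices.                              *)
Definition cycle_of_length (n : nat) : Prop :=
  3 <= n /\ exists c : seq G, size c = n /\ ucycle adj c.

Definition girth : enat := nat_inf [set n | cycle_of_length n].

Definition is_clique (C : set G) : Prop :=
  forall x y : G, C x -> C y -> x <> y -> adj x y.

(* The supremum of the cardinalities of the cliques; it need not be attained. *)
Definition clique_number : Type :=
  card_sup (fun K => exists C : set G, is_clique C /\ [set: K] #= C).

Definition is_coloring (A : Type) (f : G -> A) : Prop :=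
  forall x y : G, adj x y -> f x <> f y.

Definition chromatic_number : Type :=
  card_inf (fun A => exists f : G -> A, is_coloring f).

Lemma clique_numberP :
  is_card_inf
    (card_ub (fun K => exists C : set G, is_clique C /\ [set: K] #= C))
    clique_number.
Proof.
apply: card_infP; exists (vertex G : Type) => K [C [_ /card_eqPle[KC _]]].
exact: card_le_trans KC (subset_card_le _).
Qed.

Lemma chromatic_numberP :
  is_card_inf (fun A => exists f : G -> A, is_coloring f) chromatic_number.
Proof.
apply: card_infP; exists (vertex G : Type); exists id => x y + xy.
by rewrite xy adj_irr.
Qed.

End GraphInvariants.

HB.mixin Record Semigroup_isComSemigroup0 S of Semigroup S := {
  sgzero : S;
  sgmulC : commutative (@mul S);
  sgmul0 : left_zero sgzero (@mul S)
}.

#[short(type="comSemigroup0Type")]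
HB.structure Definition ComSemigroup0 :=
  {S of Semigroup_isComSemigroup0 S & Semigroup S}.

Declare Scope semigroup0_scope.
Delimit Scope semigroup0_scope with SG.
Notation "0" := (@sgzero _) : semigroup0_scope.
Notation "x * y" := (@mul _ x y) : semigroup0_scope.
Local Open Scope semigroup0_scope.

(* Powers without a unit element: [iterop n mul x x] is [x ^ n] when [0 < n].      *)
Definition nilpotent_free (S : comSemigroup0Type) : Prop :=
  forall (x : S) (n : nat), (0 < n)%N -> iterop n (@mul S) x x = 0 -> x = 0.

Definition zero_divisor (S : comSemigroup0Type) (s : S) : Prop :=
  exists t : S, t <> 0 /\ s * t = 0.

Record armendariz (S T : comSemigroup0Type) (g : S -> T) : Prop := Armendariz {
  armendariz_surj : forall t : T, exists s : S, g s = t;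
  armendariz_eq0 : forall s : S, s = 0 <-> g s = 0;
  armendariz_mul : forall s s' : S, s * s' = 0 <-> g s * g s' = 0
}.

Section ZeroDivisorGraph.
Variable S : comSemigroup0Type.

Definition zd_vertices : set S := [set s | s <> 0 /\ zero_divisor s].

Definition zd_adj : rel zd_vertices :=
  fun a b => (a != b) && (val a * val b == 0).

Lemma zd_adj_sym : symmetric zd_adj.
Proof. by move=> a b; rewrite /zd_adj eq_sym sgmulC. Qed.

Lemma zd_adj_irr : irreflexive zd_adj.
Proof. by move=> a; rewrite /zd_adj eqxx. Qed.

Definition zero_divisor_graph : sgraph := SGraph zd_adj_sym zd_adj_irr.

End ZeroDivisorGraph.
Arguments zd_vertices S : clear implicits.

Section InducedMap.
Variables (S T : comSemigroup0Type) (g : S -> T).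
Hypothesis g_arm : armendariz g.

Lemma armendariz_zd (s : S) : s \in zd_vertices S -> g s \in zd_vertices T.
Proof.
rewrite !inE => -[s0 [t [t0 st0]]].
split; first by move=> /(armendariz_eq0 g_arm).
exists (g t); split; first by move=> /(armendariz_eq0 g_arm).
exact/(armendariz_mul g_arm).
Qed.

Definition zd_map (a : zero_divisor_graph S) : zero_divisor_graph T :=
  exist _ (g (val a)) (armendariz_zd (valP a)).

End InducedMap.

(* Main.v *)
Require Import Defs.
From HB Require Import structures.
From mathcomp Require Import all_boot.
From mathcomp Require Import boolp classical_sets functions cardinality.

(** In a nilpotent-free semigroup a nonzero element never annihilates itself.
    Hence in the zero-divisor graph adjacency is just the vanishing of the
    product, with no separate condition that the two vertices differ, and every
    vertex has a neighbour: the witness of its being a zero-divisor.  It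
    follows that an Armendariz map induces a surjection of graphs that
    preserves and reflects adjacency ([zd_map_surj], [zd_map_mono]), so that
    the graph of [S] is obtained from that of [T] by replacing each vertex with
    a nonempty independent set.  All six claims compare a graph with such a
    blow-up.

    Distances: a walk of positive length lifts along the map with prescribed
    end points ([walk_lift]), so the distance of vertices in different fibres is
    unchanged, while two different vertices of one fibre are at distance
    exactly [2], through a common neighbour.  This affects the diameter only
    when it was [1], and then only if some fibre has two elements.

    Girth: triangles correspond in both directions and every cycle lifts along
    a section.  A blow-up may create new cycles of length [4], and here the
    semigroup intervenes: if [a - b - c - d] is a path and [ad] is nonzero, then
    [ad] is a common neighbour of [b] and [c].  So a zero-divisor graph with a
    cycle has one of length [3] or [4] ([zd_cycle34]), and the new squares can
    only change an infinite girth.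

    Cliques and colourings: the map is injective on each clique, and a section
    carries cliques and colourings back, so the two graphs have the same clique
    cardinalities and the same sets of colours. *)

Set Implicit Arguments.
Unset Strict Implicit.
Unset Printing Implicit Defensive.

Local Open Scope classical_set_scope.
Local Open Scope card_scope.

(** * Walks, diameter and short cycles in a graph *)

Section Graph.
Variable G : sgraph.

Definition diam_le (n : nat) : Prop :=
  forall x y : G, exists2 m, m <= n & walk_of_length m x y.

Lemma walk0 (x y : G) : walk_of_length 0 x y <-> x = y.
Proof.
split=> [[p [/size0nil-> _ /=]] //|->]; by exists [::].
Qed.

Lemma walk1 (x y : G) : walk_of_length 1 x y <-> adj x y.
Proof.
split=> [[[|z [|? ?]] [] //= _ /andP[xz _] <- //]|xy].
by exists [:: y]; rewrite /= xy.
Qed.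

Lemma walkS n (x y : G) :
  walk_of_length n.+1 x y <-> exists2 z, adj x z & walk_of_length n z y.
Proof.
split=> [[[|z p] [] //= [pn] /andP[xz zp] py]|[z xz [p [pn zp py]]]].
  by exists z => //; exists p.
by exists (z :: p) => /=; rewrite pn xz.
Qed.

Lemma dist_le (x y : G) n :
  enat_le (dist x y) (Fin n) <-> exists2 m, m <= n & walk_of_length m x y.
Proof.
case E: (dist x y) => [k|]; split => //=.
- by move=> kn; exists k => //; have [] := (nat_infP _ _).1 E.
- move=> [m mn xy]; apply: leq_trans mn.
  by have [_] := (nat_infP _ _).1 E; apply.
- move=> [m _ xy]; have /seteqP[+ _] := (nat_inf_infty _).1 E.
  by move/(_ m xy).
Qed.

Lemma diamE : diam G = nat_inf diam_le.
Proof.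
rewrite /diam /enat_sup; congr nat_inf; apply/seteqP; split=> n /=.
  by move=> nP x y; apply/dist_le; apply: nP; exists (x, y).
by move=> nP _ [[x y] _ <-]; apply/dist_le.
Qed.

Lemma triangleP :
  cycle_of_length G 3 <->
  exists a b c : G, [/\ adj a b, adj b c & adj c a].
Proof.
split=> [[_ [[|a [|b [|c [|? ?]]]] [] //= _ /andP[/and4P[ab bc ca _] _]]]|].
  by exists a, b, c.
move=> [a [b [c [ab bc ca]]]]; split=> //; exists [:: a; b; c]; split=> //.
rewrite /ucycle /= ab bc ca /= !inE !andbT.
have neq (x y : G) : adj x y -> x != y.
  by apply: contraTneq => ->; rewrite adj_irr.
by rewrite negb_or !neq // adj_sym.
Qed.

Lemma square_cycle (a b c d : G) :
  adj a b -> adj b c -> adj c d -> adj d a -> a != c -> b != d ->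
  cycle_of_length G 4.
Proof.
move=> ab bc cd da ac bd; split=> //; exists [:: a; b; c; d]; split=> //.
rewrite /ucycle /= ab bc cd da /= !inE !andbT !negb_or ac bd.
have neq (x y : G) : adj x y -> x != y.
  by apply: contraTneq => ->; rewrite adj_irr.
by rewrite !neq // adj_sym.
Qed.

Lemma girth3 : cycle_of_length G 3 -> girth G = Fin 3.
Proof. by move=> c3; apply/nat_infP; split=> // m []. Qed.

Lemma girth4 : ~ cycle_of_length G 3 -> cycle_of_length G 4 -> girth G = Fin 4.
Proof.
move=> n3 c4; apply/nat_infP; split=> // m cm.
have [m3 _] := cm; rewrite ltn_neqAle m3 andbT.
by apply: contra_notN n3 => /eqP->.
Qed.

End Graph.

(** * Blow-ups of graphs *)

Section Blowup.
Variables (G H : sgraph) (p : G -> H).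
Hypothesis p_surj : forall y, exists x, p x = y.
Hypothesis p_mono : {mono p : x y / adj x y}.

Lemma blowup_section : exists s : H -> G, cancel s p.
Proof.
exists (fun y => sval (cid (p_surj y))) => y; exact: svalP (cid (p_surj y)).
Qed.

Lemma section_mono (s : H -> G) : cancel s p -> {mono s : x y / adj x y}.
Proof. by move=> sK x y; rewrite -p_mono !sK. Qed.

Lemma blowup_bij : injective p -> bijective p.
Proof.
move=> p_inj; have [s sK] := blowup_section.
by exists s => // x; apply: p_inj; rewrite sK.
Qed.

Lemma walk_map n (x y : G) :
  walk_of_length n x y -> walk_of_length n (p x) (p y).
Proof.
move=> [q [qn xq <-]]; exists (map p q).
by rewrite size_map last_map (mono_path p_mono).
Qed.

(** Only the inner vertices of the walk have to be chosen in their fibres, so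
    a single step needs no choice and both ends may be prescribed. *)
Lemma walk_lift n (x y : G) :
  walk_of_length n.+1 (p x) (p y) -> walk_of_length n.+1 x y.
Proof.
elim: n x => [|n IHn] x.
  by move=> /walk1 xy; apply/walk1; rewrite -p_mono.
move=> /walkS[z' + zy]; have [z pz] := p_surj z'.
rewrite -{}pz in zy *; rewrite p_mono => xz.
by apply/walkS; exists z => //; apply: IHn.
Qed.

Lemma diam_le_base n : diam_le G n -> diam_le H n.
Proof.
move=> dG x' y'; have [x <-] := p_surj x'; have [y <-] := p_surj y'.
by have [m mn /walk_map] := dG x y; exists m.
Qed.

Lemma diam_le_inj n : injective p -> diam_le H n -> diam_le G n.
Proof.
move=> p_inj dH x y; have [[|m] mn xy] := dH (p x) (p y); last first.
  by exists m.+1 => //; exact: walk_lift.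
by exists 0 => //; apply/walk0/p_inj/walk0.
Qed.

Lemma triangle_base : cycle_of_length G 3 <-> cycle_of_length H 3.
Proof.
split=> /triangleP[a [b [c [ab bc ca]]]]; apply/triangleP.
  by exists (p a), (p b), (p c); rewrite !p_mono.
have [s sK] := blowup_section.
by exists (s a), (s b), (s c); rewrite !(section_mono sK).
Qed.

Lemma cycle_lift n : cycle_of_length H n -> cycle_of_length G n.
Proof.
have [s sK] := blowup_section.
move=> [n3 [c [cn /andP[cc uc]]]]; split=> //; exists (map s c).
rewrite size_map; split=> //; apply/andP.
by rewrite (mono_cycle (section_mono sK)) (map_inj_uniq (can_inj sK)).
Qed.

(** Two adjacent vertices never share a fibre, since their image would be
    adjacent to itself; so [p] is injective on a clique.  As the suprema need
    not be attained, the families of cardinalities are compared, not suprema. *)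
Lemma blowup_clique : clique_number G = clique_number H.
Proof.
rewrite /clique_number; congr card_sup; apply/funext => K; apply/propext.
split=> -[C [clC KC]].
  exists (p @` C); split.
    move=> _ _ [x Cx <-] [y Cy <-] nxy; rewrite p_mono.
    by apply: clC => // xy; rewrite xy in nxy.
  apply: card_eq_trans KC _; apply: card_esym; apply: inj_card_eq.
  move=> x y /set_mem Cx /set_mem Cy pxy; apply: contrapT => /(clC _ _ Cx Cy).
  by rewrite -p_mono pxy adj_irr.
have [s sK] := blowup_section; exists (s @` C); split.
  move=> _ _ [x Cx <-] [y Cy <-] nxy; rewrite (section_mono sK).
  by apply: clC => // xy; rewrite xy in nxy.
apply: card_eq_trans KC _; apply: card_esym; apply: inj_card_eq.
by move=> x y _ _; exact: can_inj sK x y.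
Qed.

Lemma blowup_chromatic : chromatic_number G = chromatic_number H.
Proof.
rewrite /chromatic_number; congr card_inf; apply/funext => A; apply/propext.
split=> -[f fP]; last by exists (f \o p) => x y xy; apply: fP; rewrite p_mono.
have [s sK] := blowup_section.
by exists (f \o s) => x y xy; apply: fP; rewrite (section_mono sK).
Qed.

Hypothesis nbr : forall x : G, exists y, adj x y.

Lemma diam_le_gt0 (x : G) n : diam_le G n -> 0 < n.
Proof.
have [y xy] := nbr x => /(_ x y)[[|m] mn] //; last by case: n mn.
by move=> /walk0 e; rewrite e adj_irr in xy.
Qed.

(** The bound [2] is what two vertices of one fibre cost: they are joined
    through any neighbour of one of them, which is adjacent to both. *)
Lemma diam_le_blowup n : 2 <= n -> diam_le H n -> diam_le G n.
Proof.
move=> n2 dH x y; have [[|m] mn xy] := dH (p x) (p y); last first.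
  by exists m.+1 => //; exact: walk_lift.
have {xy} /walk0 pxy := xy; have [z xz] := nbr x; exists 2 => //.
apply/walkS; exists z => //; apply/walk1.
by rewrite adj_sym -p_mono -pxy p_mono.
Qed.

(** Every nonempty graph involved has an edge, so the bounds [0] and [1] only
    occur for diameter [1] or for the empty graph. *)
Lemma blowup_diam : diam H <> Fin 1 -> diam G = diam H.
Proof.
move=> nH1; rewrite !diamE; congr nat_inf; apply/seteqP; split=> n /=.
  exact: diam_le_base.
have [n2|n1] := leqP 2 n; first exact: diam_le_blowup.
move=> dH x; exfalso; apply: nH1; rewrite diamE; apply/nat_infP.
have Hgt0 m : diam_le H m -> 0 < m.
  have [z xz] := nbr x => /(_ (p x) (p z))[[|k] km]; last by case: m km.
  by move=> /walk0 e; rewrite -p_mono e adj_irr in xz.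
split=> // u v; have [m mn uv] := dH u v; exists m => //.
exact: leq_trans mn _.
Qed.

Lemma blowup_diam_inj : injective p -> diam G = diam H.
Proof.
move=> p_inj; rewrite !diamE; congr nat_inf; apply/seteqP.
by split=> n; [exact: diam_le_base | exact: diam_le_inj].
Qed.

Lemma blowup_diam2 : diam H = Fin 1 -> ~ injective p -> diam G = Fin 2.
Proof.
rewrite diamE => /nat_infP[dH _] ninj; rewrite diamE; apply/nat_infP; split.
  apply: diam_le_blowup => // u v.
  by have [m m1 uv] := dH u v; exists m => //; exact: leqW.
have [x [y [pxy nxy]]] : exists x y, p x = p y /\ x <> y.
  apply: contrapT => nex; apply: ninj => x y pxy.
  by apply: contrapT => nxy; apply: nex; exists x, y.
move=> n /(_ x y)[[|[|k]] kn]; last by move=> _; exact: leq_trans _ kn.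
  by move/walk0.
by move/walk1; rewrite -p_mono pxy adj_irr.
Qed.

End Blowup.

(** * Zero-divisor graphs of nilpotent-free semigroups *)

Local Open Scope semigroup0_scope.

Section ZeroDivisor.
Variable S : comSemigroup0Type.
Hypothesis hS : nilpotent_free S.
Implicit Types a b c d : zero_divisor_graph S.

Lemma sqr_eq0 (x : S) : x * x = 0 -> x = 0.
Proof. exact: (hS (n := 2)). Qed.

Lemma zd_neq0 a : val a <> 0.
Proof. by have /set_mem[] := valP a. Qed.

Lemma zd_adjE a b : adj a b = (val a * val b == 0).
Proof.
rewrite /= /zd_adj andb_idl // => /eqP ab0; apply/eqP => ab.
by apply: (@zd_neq0 a); apply: sqr_eq0; rewrite {2}ab.
Qed.

(** This makes vertices out of semigroup elements: since annihilation is
    symmetric, whatever nonzero element kills a vertex is a vertex itself. *)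
Lemma zd_nbr a (t : S) : t <> 0 -> val a * t = 0 ->
  exists b, val b = t /\ adj a b.
Proof.
move=> t0 at0; have tV : t \in zd_vertices S.
  apply/mem_set; split=> //; exists (val a); rewrite sgmulC; split=> //.
  exact: zd_neq0.
exists (exist _ t tV : zero_divisor_graph S); split=> //.
by rewrite zd_adjE /= at0.
Qed.

Lemma zd_has_nbr a : exists b, adj a b.
Proof.
have /set_mem[_ [t [t0 /(zd_nbr t0)[b [_ ab]]]]] := valP a.
by exists b.
Qed.

(** The ends either close up to a square or have a nonzero product, which then
    is annihilated by both inner vertices and so completes a triangle on them.
    That the product differs from these two vertices is where nilpotents matter:
    otherwise an inner vertex would have square zero. *)
Lemma path3_cycle a b c d : adj a b -> adj b c -> adj c d ->
  a != c -> b != d ->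
  cycle_of_length (zero_divisor_graph S) 3 \/
  cycle_of_length (zero_divisor_graph S) 4.
Proof.
move=> ab bc cd ac bd; have [da|nda] := boolP (adj d a).
  by right; exact: square_cycle ab bc cd da ac bd.
left; apply/triangleP; rewrite zd_adjE in nda.
have bda : val b * (val d * val a) = 0.
  move: ab; rewrite adj_sym zd_adjE => /eqP ba0.
  by rewrite [val d * _]sgmulC mulgA ba0 sgmul0.
have cda : val c * (val d * val a) = 0.
  by move: cd; rewrite zd_adjE => /eqP cd0; rewrite mulgA cd0 sgmul0.
have [e [eE be]] := zd_nbr (elimN eqP nda) bda.
by exists b, c, e; split=> //; [rewrite zd_adjE eE cda | rewrite adj_sym].
Qed.

Lemma zd_cycle34 n : cycle_of_length (zero_divisor_graph S) n ->
  cycle_of_length (zero_divisor_graph S) 3 \/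
  cycle_of_length (zero_divisor_graph S) 4.
Proof.
move=> cn; have [n3 [s [sn /andP[]]]] := cn.
move: n3; rewrite leq_eqVlt => /orP[/eqP n3|]; first by left; rewrite n3.
rewrite -sn; case: s {sn} => [|a [|b [|c [|d s]]]] // _.
move=> /= /and4P[ab bc cd _] /and3P[].
rewrite !inE !negb_or => /and4P[_ ac _ _] /and3P[_ bd _] _.
exact: path3_cycle ab bc cd ac bd.
Qed.

End ZeroDivisor.

Section Armendariz.
Variables (S T : comSemigroup0Type).
Hypotheses (hS : nilpotent_free S) (hT : nilpotent_free T).
Variable rho : S -> T.
Hypothesis h : armendariz rho.

Lemma zd_map_mono : {mono zd_map h : a b / adj a b}.
Proof.
move=> a b; rewrite (zd_adjE hS) (zd_adjE hT) /=.
by apply/eqP/eqP => /(armendariz_mul h).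
Qed.

Lemma zd_map_surj (b : zero_divisor_graph T) : exists a, zd_map h a = b.
Proof.
have /set_mem[b0 [t [t0 bt]]] := valP b.
have [[s sE] [u uE]] := (armendariz_surj h (val b), armendariz_surj h t).
have sV : s \in zd_vertices S.
  apply/mem_set; split; first by move/(armendariz_eq0 h); rewrite sE.
  exists u; split; first by move/(armendariz_eq0 h); rewrite uE.
  by apply/(armendariz_mul h); rewrite sE uE.
by exists (exist _ s sV : zero_divisor_graph S); apply: val_inj.
Qed.

End Armendariz.

(** * The invariants of zero-divisor graphs under an Armendariz map *)

Theorem theorem2p6 (S T : comSemigroup0Type)
    (hS : nilpotent_free S) (hT : nilpotent_free T)
    (rho : S -> T) (h : armendariz rho) :
  let GS := zero_divisor_graph S in
  let GT := zero_divisor_graph T in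
  (diam GT <> Fin 1 -> diam GS = diam GT) /\
  (diam GT = Fin 1 ->
     (bijective (zd_map h) -> diam GS = Fin 1) /\
     (~ bijective (zd_map h) -> diam GS = Fin 2)) /\
  (girth GT <> Infty -> girth GS = girth GT) /\
  (girth GT = Infty -> girth GS = Fin 4 \/ girth GS = Infty) /\
  ([set: clique_number GS]%classic #= [set: clique_number GT]%classic)%card /\
  ([set: chromatic_number GS]%classic #= [set: chromatic_number GT]%classic)%card.
Proof.
move=> GS GT; have p_surj := zd_map_surj h; have p_mono := zd_map_mono hS hT h.
have nbr : forall a : GS, exists b, adj a b := zd_has_nbr hS.
have c3E := triangle_base p_surj p_mono.
split; first exact: blowup_diam p_surj p_mono nbr.
split.
  move=> dT; split=> [/bij_inj p_inj|nbij].
    by rewrite -dT; exact: blowup_diam_inj p_surj p_mono p_inj.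
  by apply: (blowup_diam2 p_surj p_mono nbr dT) => /(blowup_bij p_surj).
split.
  move=> gT; have [c3|n3] := pselect (cycle_of_length GT 3).
    by rewrite (girth3 c3) girth3 //; apply/c3E.
  have c4 : cycle_of_length GT 4.
    apply: contrapT => n4; apply: gT; apply/nat_inf_infty.
    by rewrite -subset0 => n /(zd_cycle34 hT)[].
  rewrite (girth4 n3 c4); apply: girth4; first by move=> /c3E.
  exact: (cycle_lift p_surj p_mono c4).
split.
  move=> /nat_inf_infty gT0.
  have n3 : ~ cycle_of_length GS 3.
    by move=> /c3E c3; have /seteqP[/(_ 3 c3)] := gT0.
  have [c4|n4] := pselect (cycle_of_length GS 4); first by left; exact: girth4.
  right; apply/nat_inf_infty; rewrite -subset0 => n.
  by move=> /(zd_cycle34 hS)[].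
rewrite (blowup_clique p_surj p_mono) (blowup_chromatic p_surj p_mono).
by split; exact: card_eqxx.
Qed.
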